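(* In the setting of the context, assume in addition that $p$ is even, i.e. $p(-x)=p(x)$ for all $x$. Then for every integer $m\ge 0$ there is a constant $C_m$ (depending on $m$ and $p$) such that for all $N\ge1$, \[ \mathbb{E}\Big[\big|M_m(A,N)-\mathbb{E}[M_m(A,N)]\big|^4\Big]\;\le\;\frac{C_m}{N^2}. \]
   Context: Let $p$ be a probability density on $\mathbb{R}$ with mean $0$, variance $1$ and finite moments of all orders. For $N\ge 1$, let $b_1,\dots,b_{N-1}$ be independent random variables with density $p$, set $b_0=0$, and let $A=A_N$ be the $N\times N$ real symmetric Toeplitz matrix with entries $a_{ij}=b_{|i-j|}$ ($1\le i,j\le N$). Let $\lambda_1(A),\dots,\lambda_N(A)$ be its eigenvalues. For an integer $k\ge 0$ define $M_k(A,N)=N^{-(k/2+1)}\sum_{i=1}^N\lambda_i(A)^k = N^{-(k/2+1)}\,\mathrm{Trace}(A^k)$, and $M_k(N)=\mathbb{E}[M_k(A,N)]$, the expectation over the random entries. *)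

(* Defs.v *)
From HB Require Import structures.
From mathcomp Require Import all_boot all_order all_algebra.
From mathcomp Require Import all_classical all_reals all_analysis.
Set Implicit Arguments. Unset Strict Implicit. Unset Printing Implicit Defensive.
Import Order.TTheory GRing.Theory Num.Theory.
Import numFieldNormedType.Exports.
Local Open Scope classical_set_scope.
Local Open Scope ring_scope.

Definition toeplitz (R : pzRingType) (N : nat) (b : nat -> R) : 'M[R]_N :=
  \matrix_(i < N, j < N) (if `|i - j|%N == 0%N then 0 else b `|i - j|%N).

Definition Mstat (R : realType) (N k : nat) (b : nat -> R) : R :=
  (N%:R `^ (- (k%:R / 2 + 1))) * \tr ((toeplitz N b) ^+ k).

Definition is_density (R : realType) (p : R -> R) : Prop :=
  (forall x, 0 <= p x) /\ measurable_fun setT p /\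
  (\int[@lebesgue_measure R]_x (p x)%:E = 1)%E.

Definition mean0_var1_all_moments (R : realType) (p : R -> R) : Prop :=
  (forall k : nat, (@lebesgue_measure R).-integrable setT (fun x => (x ^+ k * p x)%:E)) /\
  (\int[@lebesgue_measure R]_x (x * p x)%:E = 0)%E /\
  (\int[@lebesgue_measure R]_x (x ^+ 2 * p x)%:E = 1)%E.

Definition has_density d (T : measurableType d) (R : realType) (P : probability T R)
  (X : T -> R) (p : R -> R) : Prop :=
  forall A : set R, measurable A ->
    P (X @^-1` A) = (\int[@lebesgue_measure R]_(x in A) (p x)%:E)%E.

(* b_1, b_2, ... are mutually independent, each with density p
   (b 0 is ignored: the matrix uses b_0 = 0) *)
Definition iid_density d (T : measurableType d) (R : realType) (P : probability T R)
  (b : nat -> T -> R) (p : R -> R) : Prop :=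
  (forall i, (0 < i)%N -> has_density P (b i) p) /\
  (forall (s : seq nat) (A : nat -> set R),
     uniq s -> all (fun i => 0 < i)%N s -> (forall i, measurable (A i)) ->
     P (\big[setI/setT]_(i <- s) (b i @^-1` A i)) =
     (\prod_(i <- s) P (b i @^-1` A i))%E).

(* Main.v *)
(** Write [Tr A^m] as the sum, over closed words [i_0 ... i_m = i_0] in [{1..N}], of
the monomials [prod_s b_(|i_s - i_(s+1)|)].  Then [E (Tr A^m - E Tr A^m)^4] is a sum over
quadruples of closed words of joint central moments, each bounded in terms of [m] and [p].
Such a moment vanishes when some gap [|i_s - i_(s+1)|] has odd total multiplicity (odd
moments of [p] are zero), and when one of the words shares no gap with the three others
(independence).  A remaining quadruple is determined by its four starting points, a
combinatorial pattern and the values of its distinct gaps, of which there are at most [2m];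
the closing equations of the words leave at most [2m - 2] of these values free, so there are
[O(N^(2m+2))] such quadruples, to be compared with the normalisation [N^(-4(m/2+1))]. *)
Require Import Defs.
From HB Require Import structures.
From mathcomp Require Import all_boot all_order all_algebra.
From mathcomp Require Import all_classical all_reals all_analysis.
From mathcomp Require Import measurable_realfun zify ring.
Import Order.TTheory GRing.Theory Num.Theory.
Import numFieldNormedType.Exports.
Local Open Scope ring_scope.
Set Implicit Arguments. Unset Strict Implicit. Unset Printing Implicit Defensive.

(** * Counting quadruples of closed words *)

Section shared_values.
Local Open Scope nat_scope.
Variables (m : nat) (V : finType) (v : 'I_4 -> 'I_m -> V).

Let occ a x := #|[set s | v a s == x]|.
Let cnt x := \sum_a occ a x.

Let occ_gt0 a s : 0 < occ a (v a s).
Proof. by apply/card_gt0P; exists s; rewrite inE. Qed.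

Let occ1P a x : occ a x = 1 -> exists s, v a s = x /\ forall s', s' != s -> v a s' != x.
Proof.
move=> /eqP/cards1P[s E]; exists s; split.
  have : s \in [set s | v a s == x] by rewrite E set11.
  by rewrite inE => /eqP.
move=> s' s's; apply: contra_neqN s's => vs'.
have : s' \in [set s | v a s == x] by rewrite inE.
by rewrite E inE => /eqP.
Qed.

Let cnt2 a b x : a != b -> occ a x + occ b x <= cnt x.
Proof.
move=> ab; rewrite /cnt (bigD1 a)//= (bigD1 b) 1?eq_sym//=.
by rewrite addnA leq_addr.
Qed.

Let cnt3 a b c x : a != b -> c != a -> c != b -> occ a x + occ b x + occ c x <= cnt x.
Proof.
move=> ab ca cb; rewrite /cnt (bigD1 a)//= (bigD1 b) 1?eq_sym//= (bigD1 c) ?ca ?cb//=.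
by rewrite !addnA leq_addr.
Qed.

Let S := [set v q.1 q.2 | q : 'I_4 * 'I_m].

Let inS a s : v a s \in S.
Proof. by apply/imsetP; exists (a, s). Qed.

Let sum_cnt : \sum_(x in S) cnt x = 4 * m.
Proof.
transitivity (\sum_(x : V) cnt x).
  rewrite [RHS](bigID (mem S))/= [X in _ + X]big1 ?addn0// => x xS.
  rewrite /cnt big1// => a _; apply/eqP; rewrite cards_eq0; apply/set0Pn => -[s].
  by rewrite inE => /eqP E; rewrite -E inS in xS.
rewrite /cnt exchange_big/=.
transitivity (\sum_(a < 4) m); last by rewrite sum_nat_const card_ord.
apply: eq_bigr => a _; rewrite -[RHS]card_ord -sum1_card (partition_big (v a) xpredT)//=.
by apply: eq_bigr => x _; rewrite /occ -sum1_card; apply: eq_bigl => s; rewrite inE.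
Qed.

(* [F] is the set of free values.  Once they are known, [x] and then [y] can be solved for,
   in rows where they occur exactly once.  If two rows share a value of multiplicity exactly
   two, then each of them contains it once; every other shared value has multiplicity at
   least four, which lowers the number of distinct values. *)
Lemma shared_values_determined :
    (forall x, ~~ odd (\sum_a #|[set s | v a s == x]|)) ->
    (forall a, exists b s t, [/\ b != a & v a s = v b t]) ->
  exists (F : {set V}) (x y : V),
  [/\ #|F| <= m.*2 - 2,
      forall a s, [|| v a s \in F, v a s == x | v a s == y],
      x \in F \/ exists a s, v a s = x /\ (forall s', s' != s -> v a s' \in F) &
      y \in F \/ exists a s, v a s = y /\ (forall s', s' != s -> v a s' != y)].
Proof.
move=> cnt_even shared.
(* Rows [ord0] and [b] share [y]; a third row [c] shares [x] with some row [e]. Hence either [x] and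
   [y] differ, or [y] lies in three rows. *)
have [b [s0 [t0 [b0 E0]]]] := shared ord0.
have [c /andP[c0 cb]] : exists c : 'I_4, (c != ord0) && (c != b).
  have : 0 < #|~: [set ord0; b]|.
    by have := cardsC [set ord0; b]; rewrite card_ord; have := cards2 (@ord0 3) b; lia.
  by case/card_gt0P => c; rewrite !inE negb_or; exists c.
have [e [s1 [t1 [ec E1]]]] := shared c.
set y := v ord0 s0 in E0; set x := v c s1 in E1.
have yS : y \in S by exact: inS.
have xS : x \in S by exact: inS.
have y0 : 0 < occ ord0 y by exact: occ_gt0.
have yb : 0 < occ b y by rewrite E0 occ_gt0.
have xc : 0 < occ c x by exact: occ_gt0.
have xe : 0 < occ e x by rewrite E1 occ_gt0.
have cnt_ge2 z : z \in S -> 2 <= cnt z.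
  case/imsetP => -[a s] _ ->; have := cnt_even (v a s); rewrite -/(cnt _).
  have : 0 < cnt (v a s) by rewrite /cnt (bigD1 a)//= ltn_addr.
  by case: cnt => [//|[|]].
have cnt_ge4 z : z \in S -> cnt z != 2 -> 4 <= cnt z.
  by move=> /cnt_ge2; have := cnt_even z; rewrite -/(cnt _); case: cnt => [|[|[|[|]]]].
(* The multiplicities sum to [4 * m]. If each element of [F] is charged 2 and [x] and [y] are
   charged 2 more each, then [2 * #|F| + 4 <= 4 * m]. *)
have F_small (F : {set V}) : F \subset S ->
    (forall z, z \in S -> 2 * (z \in F) + (2 * (z == x) + 2 * (z == y)) <= cnt z) ->
    #|F| <= m.*2 - 2.
  move=> FS Fcnt; suff : 2 * #|F| + 4 <= 4 * m by lia.
  rewrite -sum_cnt.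
  apply: (@leq_trans (\sum_(z in S) (2 * (z \in F) + (2 * (z == x) + 2 * (z == y)))));
    last exact: leq_sum.
  have sum1 w : w \in S -> \sum_(z in S) 2 * (z == w) = 2.
    move=> wS; rewrite (bigD1 w)//= eqxx big1 ?addn0// => z /andP[_ /negPf ->].
    by rewrite muln0.
  rewrite big_split [X in _ <= _ + X]big_split !sum1// leq_add2r -big_distrr/= leq_mul2l.
  rewrite -sum1_card big_mkcond/=.
  rewrite [leqRHS]big_mkcond/= leq_sum// => z _.
  by case: (boolP (z \in F)) => // /(fintype.subsetP FS) ->.
clearbody x y; clear E0 E1.
(* If [x = y], this value lies in three rows, so its even multiplicity is at least 4. With 6 or more
   it can stay free; with exactly 4, one of the three rows contains it once. *)
have [xy|xy] := eqVneq x y.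
  subst x.
  have cy := cnt3 y b0 cb c0.
  have cy4 : 4 <= cnt y by apply: cnt_ge4 => //; lia.
  have [cy6|cy6] := leqP 6 (cnt y).
    exists S, y, y; split; try by left.
      apply: F_small => // z zS; rewrite zS.
      by case: eqVneq => [->|_]; [lia|have := cnt_ge2 z zS; lia].
    by move=> a s; rewrite inS.
  have cy_eq : cnt y = 4 by have := cnt_even y; rewrite -/(cnt _); lia.
  have [a oa] : exists a, occ a y = 1.
    have [|ob] := eqVneq (occ b y) 1; first by exists b.
    have [|o0] := eqVneq (occ ord0 y) 1; first by exists ord0.
    by exists c; move: cy; rewrite cy_eq; lia.
  have [s [vs vs']] := occ1P oa.
  exists (S :\ y), y, y; split.
  - apply: F_small; first exact: subD1set.
    move=> z zS; rewrite !inE zS.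
    by case: eqVneq => [->|_]; [lia|have := cnt_ge2 z zS; lia].
  - by move=> a' s'; rewrite !inE inS; case: eqVneq.
  - by right; exists a, s; split=> // s' /vs' ss'; rewrite !inE inS andbT.
  - by right; exists a, s; split.
(* Only [x] and [y] may leave the free values, and only with multiplicity 2; with multiplicity at
   least 4 they can stay and still pay the extra charge. *)
pose F := [set z in S | ~~ (((z == x) || (z == y)) && (cnt z == 2))].
have inF z : z \in S -> z != x -> z != y -> z \in F by rewrite !inE => -> /negPf-> /negPf->.
exists F, x, y; split.
- apply: F_small; first by apply/fintype.subsetP => z; rewrite inE => /andP[].
  move=> z zS; rewrite inE zS.
  have : ~~ ((z == x) && (z == y)) by apply: contraNN xy => /andP[/eqP<- /eqP<-].
  have [c2|c4] := eqVneq (cnt z) 2.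
    by rewrite c2 andbT; case: (z == x); case: (z == y).
  have := cnt_ge4 z zS c4; rewrite andbF.
  by case: (z == x); case: (z == y) => //=; lia.
- move=> a s; have [//|] := boolP (v a s \in F); rewrite inE inS negbK /=.
  by case/andP.
- have [|] := boolP (x \in F); first by left.
  rewrite inE xS eqxx negbK/= => /eqP c2; right.
  have oc : occ c x = 1 by have := cnt2 x ec; lia.
  have [s [vs vs']] := occ1P oc; exists c, s; split=> // s' ss'.
  (* If row [c] contains [y], then [y] lies in three rows, so its multiplicity is not 2 and it is
     free. This is why [x] can be solved for before [y]. *)
  have [E|] := eqVneq (v c s') y; last by apply: inF => //; exact: vs'.
  have yc : 0 < occ c y by rewrite -E occ_gt0.
  have cy : cnt y != 2 by have := cnt3 y b0 cb c0; lia.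
  by rewrite E inE yS (negPf cy) andbF.
- have [|] := boolP (y \in F); first by left.
  rewrite inE yS eqxx orbT negbK/= => /eqP c2; right.
  have oc : occ ord0 y = 1 by have := cnt2 y b0; lia.
  by have [s [vs vs']] := occ1P oc; exists ord0, s.
Qed.

End shared_values.

(** * Words, their gaps and the encoding of balanced quadruples *)

Section words.
Variables (N m : nat).

(** The starting vertex is kept apart from the [m] later ones: it is part of a code and serves as
    the default of [nth]. *)
Definition word := ('I_N * m.-tuple 'I_N)%type.

Definition vtx (w : word) (s : nat) : 'I_N := nth w.1 (w.1 :: w.2) s.

Definition closed_word (w : word) := vtx w m == w.1.

Lemma gap_subproof (i j : 'I_N) : (`|i - j| < N)%N.
Proof. by have := ltn_ord i; have := ltn_ord j; lia. Qed.

Definition gap (w : word) (s : 'I_m) : 'I_N :=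
  Ordinal (gap_subproof (vtx w s) (vtx w s.+1)).

Definition mult (w : word) (k : nat) : nat := #|[set s | gap w s == k :> nat]|.

Definition incr (w : word) (s : nat) : int := (vtx w s.+1)%:Z - (vtx w s)%:Z.

Lemma sum_incr w : closed_word w -> \sum_(s < m) incr w s = 0.
Proof.
move=> /eqP wc; rewrite -(big_mkord xpredT (incr w)).
by rewrite (telescope_sumr (fun s => (vtx w s)%:Z))// wc subrr.
Qed.

Lemma incrE w (s : 'I_m) :
  incr w s = if (vtx w s <= vtx w s.+1)%N then (gap w s)%:Z else - (gap w s)%:Z.
Proof. by rewrite /incr /gap/=; case: ifP => h; lia. Qed.

Lemma gap_incr w (s : 'I_m) : (gap w s : nat) = `|incr w s|%N.
Proof. by rewrite /incr /gap/=; lia. Qed.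

Lemma word_inj w w' : w.1 = w'.1 -> (forall s : 'I_m, incr w s = incr w' s) -> w = w'.
Proof.
move=> w1 ww; have E s : (s <= m)%N -> vtx w s = vtx w' s.
  elim: s => [|s IH] sm; first exact: w1.
  apply: val_inj; have := ww (Ordinal sm); have := IH (ltnW sm).
  by rewrite /incr/= => ->; lia.
case: w w' w1 {ww} E => [i t] [i' t'] /= <- E; congr (_, _).
apply: eq_from_tnth => s; rewrite !(tnth_nth i).
by have := E s.+1 (ltn_ord s).
Qed.

(** The increments of a closed word sum to zero; this closing equation recovers one of them from the
    others. *)
Lemma closed_incr w w' (s : 'I_m) : closed_word w -> closed_word w' ->
  (forall s', s' != s -> incr w s' = incr w' s') -> incr w s = incr w' s.
Proof.
move=> /sum_incr w0 /sum_incr w0' E.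
have : \sum_(s < m) incr w s = \sum_(s < m) incr w' s by rewrite w0 w0'.
rewrite (bigD1 s)//= [X in _ = X -> _](bigD1 s)//= (eq_bigr _ E).
exact: addIr.
Qed.

(** Among quadruples of closed words, the joint central moment vanishes outside these: the second
    condition rules out odd moments, the third a word independent of the other three. *)
Definition balanced (f : {ffun 'I_4 -> word}) :=
  [&& [forall a, closed_word (f a)],
      [forall x : 'I_N, ~~ odd (\sum_a mult (f a) x)] &
      [forall a, exists b, (b != a) &&
        [exists x : 'I_N, (0 < mult (f a) x)%N && (0 < mult (f b) x)%N]]].

(* In a code, [inl i] marks a step whose gap is the [i]-th free value, [inr true] and
   [inr false] those whose gap is recovered from a closing equation, the latter after the
   former; the boolean is the sign of the step. *)
Let M := (m.*2 - 2)%N.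
Let pattern := {ffun 'I_4 * 'I_m -> ('I_M + bool) * bool}.
Let code := ({ffun 'I_4 -> 'I_N} * {ffun 'I_M -> 'I_N} * pattern)%type.

(** Each mark is either absent or occurs once in some row whose other gaps are known by then: free
    ones for [inr true], free or [inr true] ones for [inr false]. *)
Let solvable (k : pattern) :=
  ((forall q, (k q).1 != inr true) \/
   exists a s, (k (a, s)).1 = inr true /\ forall s', s' != s -> exists i, (k (a, s')).1 = inl i) /\
  ((forall q, (k q).1 != inr false) \/
   exists a s, (k (a, s)).1 = inr false /\ forall s', s' != s -> (k (a, s')).1 != inr false).

Let codes (f : {ffun 'I_4 -> word}) (c : code) :=
  [/\ forall a, (f a).1 = c.1.1 a,
      forall a s i, (c.2 (a, s)).1 = inl i -> gap (f a) s = c.1.2 i,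
      forall a s b t e, (c.2 (a, s)).1 = inr e -> (c.2 (b, t)).1 = inr e ->
         gap (f a) s = gap (f b) t,
      forall a s, (c.2 (a, s)).2 = (vtx (f a) s <= vtx (f a) s.+1)%N &
      solvable c.2].

(** Decoding goes through free gaps, then [inr true], then [inr false]. Signs turn known gaps into
    increments, the closing equation gives the missing increment of a row, and its absolute value is
    the missing gap. *)
Let codes_inj (f f' : {ffun 'I_4 -> word}) (c : code) :
  (forall a, closed_word (f a)) -> (forall a, closed_word (f' a)) ->
  codes f c -> codes f' c -> f = f'.
Proof.
move=> fc fc' [f1 finl finr fs [st sf]] [f1' finl' finr' fs' _].
have incr_gap a (s : 'I_m) : gap (f a) s = gap (f' a) s -> incr (f a) s = incr (f' a) s.
  by rewrite !incrE -fs -fs' => ->.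
have gap_incr' a (s : 'I_m) : incr (f a) s = incr (f' a) s -> gap (f a) s = gap (f' a) s.
  by move=> E; apply: ord_inj; rewrite !gap_incr E.
have Einl a s i : (c.2 (a, s)).1 = inl i -> gap (f a) s = gap (f' a) s.
  by move=> E; rewrite (finl _ _ _ E) (finl' _ _ _ E).
have Et a s : (c.2 (a, s)).1 = inr true -> gap (f a) s = gap (f' a) s.
  move=> E; case: st => [/(_ (a, s))|[b [t [bt tt]]]]; first by rewrite E.
  rewrite (finr _ _ _ _ _ E bt) (finr' _ _ _ _ _ E bt); apply: gap_incr'.
  apply: closed_incr => // t' /tt[i E']; apply: incr_gap; exact: Einl E'.
have Ef a s : (c.2 (a, s)).1 = inr false -> gap (f a) s = gap (f' a) s.
  move=> E; case: sf => [/(_ (a, s))|[b [t [bt tt]]]]; first by rewrite E.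
  rewrite (finr _ _ _ _ _ E bt) (finr' _ _ _ _ _ E bt); apply: gap_incr'.
  apply: closed_incr => // t' /tt; case E': (c.2 (b, t')).1 => [i|[]]// _; apply: incr_gap.
    exact: Einl E'.
  exact: Et.
apply/ffunP => a; apply: word_inj => [|s]; first by rewrite f1 f1'.
apply: incr_gap; case E: (c.2 (a, s)).1 => [i|[]]; [exact: Einl E|exact: Et|exact: Ef].
Qed.

Let codes_ex (f : {ffun 'I_4 -> word}) : balanced f -> exists c, codes f c.
Proof.
move=> /and3P[_ /forallP even_f /forallP shared_f].
have [] := @shared_values_determined m 'I_N (fun a s => gap (f a) s).
- by move=> x; have := even_f x.
- move=> a; have /existsP[b /andP[ba /existsP[x /andP[/card_gt0P[s] + /card_gt0P[t]]]]] := shared_f a.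
  rewrite !inE => /eqP xs /eqP xt; exists b, s, t; split=> //.
  by apply: ord_inj; rewrite xs xt.
move=> F [x [y [FM cover xF yF]]].
pose g : {ffun 'I_M -> 'I_N} := [ffun i : 'I_M => nth x (enum F) i].
(* For [z] in [F] the index is below [#|F| <= M], so [insub] succeeds. Outside [F] a gap is [x] or
   [y]; if these coincide, only the mark [inr true] occurs. *)
pose r (z : 'I_N) : 'I_M + bool := if z \in F then
    if insub (index z (enum F)) is Some i then inl i else inr true
  else inr (z == x).
have rF z : z \in F -> exists2 i, r z = inl i & g i = z.
  move=> zF; have lt : (index z (enum F) < M)%N.
    by rewrite (leq_trans _ FM)// cardE index_mem mem_enum.
  by exists (Ordinal lt); rewrite /r ?zF ?insubT// ffunE/= nth_index// mem_enum.
have rinl z i : r z = inl i -> g i = z.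
  have [/rF[j -> <-] [<-]//|zF] := boolP (z \in F).
  by rewrite /r (negPf zF).
have rinr z e : r z = inr e -> z \notin F /\ (z == x) = e.
  have [/rF[j -> _]//|zF] := boolP (z \in F).
  by rewrite /r (negPf zF) => -[].
have rNF z : z \notin F -> r z = inr (z == x) by rewrite /r => /negPf ->.
have cover' a s e : r (gap (f a) s) = inr e -> gap (f a) s = if e then x else y.
  move=> /rinr[zF <-]; have := cover a s; rewrite (negPf zF)/=.
  by case: eqVneq => //= _ /eqP.
exists ([ffun a => (f a).1], g,
  [ffun q => (r (gap (f q.1) q.2), (vtx (f q.1) q.2 <= vtx (f q.1) q.2.+1)%N)]).
split=> /=.
- by move=> a; rewrite ffunE.
- by move=> a s i; rewrite ffunE => /rinl.
- by move=> a s b t e; rewrite !ffunE/= => /cover' -> /cover' ->.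
- by move=> a s; rewrite ffunE.
split.
- have [xinF|xF'] := boolP (x \in F).
    left=> -[a s]; rewrite ffunE/=; apply/eqP => /[dup] /rinr[zF _] /cover' E.
    by rewrite E xinF in zF.
  right; case: xF => [|[a [s [xs tF]]]]; first by rewrite (negPf xF').
  exists a, s; rewrite ffunE/= xs rNF// eqxx; split=> // t /tF /rF[i ri _].
  by exists i; rewrite ffunE.
have [yinF|yF'] := boolP ((y \in F) || (y == x)).
  left=> -[a s]; rewrite ffunE/=; apply/eqP => /[dup] /rinr[zF zx] /cover' E.
  by move: yinF; rewrite -E (negPf zF) zx.
move: yF'; rewrite negb_or => /andP[yF' yx].
right; case: yF => [|[a [s [ys tF]]]]; first by rewrite (negPf yF').
exists a, s; rewrite ffunE/= ys rNF// (negPf yx); split=> // t /tF ty.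
by rewrite ffunE/=; apply: contra ty => /eqP/cover' ->.
Qed.

(** A code has four starting points, [M] free values and a pattern, whence the exponent
    [M + 4 = m.*2 + 2] and the base [(M + 2) * 2 = m.*2 * 2]. At [m = 0] truncated subtraction
    breaks these identities, but words without steps share no gap. *)
Lemma card_balanced :
  (#|balanced| <= (m.*2 * 2) ^ (4 * m) * N ^ (m.*2 + 2))%N.
Proof.
have [m0|m0] := posnP m.
  rewrite eq_card0// => f; apply/negP => /and3P[_ _ /forallP/(_ ord0)].
  case/existsP => b /andP[_ /existsP[x /andP[/card_gt0P[s] _ _]]].
  by have := ltn_ord s; rewrite {2}m0.
have /choice[F HF] : forall f : {f | balanced f}, exists c, codes (val f) c.
  by move=> [f fb]; exact: codes_ex.
have Finj : injective F.
  move=> f f' E; apply: val_inj; apply: (@codes_inj _ _ (F f)); last by rewrite E.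
  - by have /and3P[/forallP] := valP f.
  - by have /and3P[/forallP] := valP f'.
  - exact: HF.
have := leq_card F Finj.
rewrite card_sig => /leq_trans; apply.
rewrite !card_prod !card_ffun !card_ord !card_prod !card_sum !card_ord card_bool.
rewrite mulnC -expnD; apply: eq_leq; congr (_ ^ _ * _ ^ _)%N; rewrite /M; lia.
Qed.

End words.

(** * Joint central moments *)

(** The power is distributed twice: over a word for each of the [r] factors, then over the set [q.2]
    of factors contributing their monomial rather than the constant. This leaves a linear
    combination of monomials. *)
Lemma expr_sum_sub (R : comNzRingType) (W : finType) (Q : pred W) (r N : nat)
    (x : nat -> R) (c : W -> nat -> nat) (e : W -> R) :
  (\sum_(w | Q w) \prod_(k < N) x k ^+ c w k - \sum_(w | Q w) e w) ^+ r =
  \sum_(q : {ffun 'I_r -> W} * {set 'I_r} | q.1 \in ffun_on Q)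
     (\prod_(a | a \notin q.2) - e (q.1 a)) *
     \prod_(k < N) x k ^+ (\sum_(a in q.2) c (q.1 a) k).
Proof.
rewrite -sumrB -{1}(card_ord r) -prodr_const bigA_distr_big.
transitivity (\sum_(f in ffun_on Q) \sum_(J : {set 'I_r})
    (\prod_(a | a \notin J) - e (f a)) * \prod_(k < N) x k ^+ (\sum_(a in J) c (f a) k));
  last by rewrite pair_big_dep; apply: eq_bigl => q; rewrite andbT.
apply: eq_bigr => f _; rewrite bigA_distr/=; apply: eq_bigr => J _.
rewrite (bigID (mem J))/= mulrC; congr (_ * _).
  by apply: eq_bigr => a /negPf ->.
under eq_bigr => a -> do [].
by rewrite exchange_big; apply: eq_bigr => k _; rewrite prodrXr.
Qed.

Section joint_moment.
Variables (R : realDomainType) (r N : nat) (nu : nat -> nat -> R).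

Definition mono_moment (c : nat -> nat) : R := \prod_(k < N) nu k (c k).

(* The expectation of [prod_a (X_a - E X_a)], expanded over the set [J] of factors in which
   [X_a] is chosen, where [X_a] is the monomial with exponents [c a] in independent variables
   whose moments are given by [nu]. *)
Definition joint_moment (c : 'I_r -> nat -> nat) : R :=
  \sum_(J : {set 'I_r}) (\prod_(a | a \notin J) - mono_moment (c a)) *
     mono_moment (fun k => \sum_(a in J) c a k)%N.

(** An odd total exponent is odd either in the sum over [J] or for a single factor outside [J];
    either way the term of [J] contains an odd moment. *)
Lemma joint_moment_odd (c : 'I_r -> nat -> nat) (k : 'I_N) :
  (forall k j, odd j -> nu k j = 0) -> odd (\sum_a c a k) -> joint_moment c = 0.
Proof.
move=> nu_odd oc.
have mono0 (c' : nat -> nat) : odd (c' k) -> mono_moment c' = 0.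
  by move=> /nu_odd o; rewrite /mono_moment (bigD1 k)//= o mul0r.
rewrite /joint_moment big1// => J _.
move: oc; rewrite (bigID (mem J))/= oddD.
have [oJ _|_] := boolP (odd (\sum_(a in J) c a k)%N); first by rewrite mono0 ?mulr0.
rewrite addFb => oJ.
have /existsP[a /andP[aJ oa]] : [exists a, (a \notin J) && odd (c a k)].
  apply: contraTT oJ; rewrite negb_exists => /forallP even_c.
  apply: (big_ind (fun n => ~~ odd n)) => // [m n em en|a aJ]; first by rewrite oddD (negPf em).
  by have := even_c a; rewrite aJ.
by rewrite (bigD1 a)//= mono0// oppr0 !mul0r.
Qed.

(** The terms of [J] and [a0 |: J] cancel: [a0] shares no variable with the other factors, so its
    moment splits off. *)
Lemma joint_moment_isolated (c : 'I_r -> nat -> nat) (a0 : 'I_r) :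
  (forall k, nu k 0%N = 1) ->
  (forall a (k : 'I_N), a != a0 -> c a0 k = 0%N \/ c a k = 0%N) ->
  joint_moment c = 0.
Proof.
move=> nu0 c0; rewrite /joint_moment (bigID (fun J : {set 'I_r} => a0 \in J))/=.
rewrite (reindex_onto (fun J => a0 |: J) (fun J => J :\ a0))/=; last first.
  by move=> J; exact: finset.setD1K.
have predE (J : {set 'I_r}) : (a0 \in a0 |: J) && ((a0 |: J) :\ a0 == J) = (a0 \notin J).
  rewrite finset.setU11/=; have [aJ|aJ] := boolP (a0 \in J); last by rewrite finset.setU1K ?eqxx.
  by apply/negP => /eqP E; rewrite -E finset.setD11 in aJ.
rewrite (eq_bigl _ _ predE).
rewrite -big_split big1//= => J aJ.
rewrite [X in _ + X * _](bigD1 a0)//=.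
have -> : mono_moment (fun k => \sum_(a in a0 |: J) c a k)%N =
    mono_moment (c a0) * mono_moment (fun k => \sum_(a in J) c a k)%N.
  rewrite /mono_moment -big_split; apply: eq_bigr => k _ /=.
  rewrite big_setU1//=; have [->|c0k] := eqVneq (c a0 k) 0%N; first by rewrite nu0 mul1r.
  rewrite big1 ?addn0 ?nu0 ?mulr1// => a aJ'.
  case: (c0 a k) => // [|E]; first by apply: contraNneq aJ => <-.
  by rewrite E eqxx in c0k.
have predJ a : (a \notin a0 |: J) = (a \notin J) && (a != a0).
  by rewrite !inE negb_or andbC.
rewrite (eq_bigl _ _ predJ).
by rewrite mulrA mulNr mulNr -mulrA (mulrCA (\prod_(_ | _) _)) mulrA subrr.
Qed.

(** The bounds [K ^+ j] multiply, so each [J] contributes at most [K] to the total degree, which is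
    at most [r * m]. *)
Lemma norm_joint_moment (c : 'I_r -> nat -> nat) (m : nat) (K : R) :
  1 <= K -> (forall k j, (j <= r * m)%N -> `|nu k j| <= K ^+ j) ->
  (forall a, \sum_(k < N) c a k <= m)%N ->
  `|joint_moment c| <= #|{set 'I_r}|%:R * K ^+ (r * m).
Proof.
move=> K1 nuK cm.
have mono_le (c' : nat -> nat) : (\sum_(k < N) c' k <= r * m)%N ->
    `|mono_moment c'| <= K ^+ (\sum_(k < N) c' k).
  move=> c'm; rewrite /mono_moment normr_prod -prodrXr.
  apply: ler_prod => k _; rewrite normr_ge0 nuK// (leq_trans _ c'm)//.
  by rewrite (bigD1 k)//= leq_addr.
have sum_le : (\sum_a \sum_(k < N) c a k <= r * m)%N.
  by apply: leq_trans (leq_sum _ (fun a _ => cm a)) _; rewrite sum_nat_const card_ord.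
rewrite mulr_natl -sumr_const; apply: le_trans (ler_norm_sum _ _ _) _.
apply: ler_sum => J _.
apply: (@le_trans _ _ (K ^+ (\sum_a \sum_(k < N) c a k))); last exact: ler_weXn2l.
have E : (\sum_a \sum_(k < N) c a k = \sum_(a | a \notin J) \sum_(k < N) c a k +
   \sum_(k < N) \sum_(a in J) c a k)%N.
  by rewrite (bigID (mem J))/= addnC [in X in (_ + X)%N]exchange_big.
rewrite E exprD normrM ler_pM//; last by rewrite mono_le// (leq_trans _ sum_le)// E leq_addl.
rewrite normr_prod -prodrXr; apply: ler_prod => a aJ.
rewrite normr_ge0 normrN mono_le//= (leq_trans _ sum_le)//.
by rewrite (bigD1 a)//= leq_addr.
Qed.

End joint_moment.

Lemma sum_mult (N m : nat) (w : word N m) : (\sum_(k < N) mult w k)%N = m.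
Proof.
rewrite -[RHS]card_ord -sum1_card (partition_big (gap w) xpredT)//=.
by apply: eq_bigr => k _; rewrite /mult -sum1_card; apply: eq_bigl => s; rewrite inE.
Qed.

Lemma joint_moment_unbalanced (R : realDomainType) (N m : nat) (nu : nat -> nat -> R)
    (f : {ffun 'I_4 -> word N m}) :
  (forall k, nu k 0%N = 1) -> (forall k j, odd j -> nu k j = 0) ->
  (forall a, closed_word (f a)) -> ~~ balanced f ->
  joint_moment N nu (fun a => mult (f a)) = 0.
Proof.
move=> nu0 nu_odd fc; rewrite /balanced !negb_and.
have -> /= : [forall a, closed_word (f a)] by exact/forallP.
case/orP => [/=|]; first by rewrite negb_forall => /existsP[k] /negPn; exact: joint_moment_odd.
rewrite negb_forall => /existsP[a]; rewrite negb_exists => /forallP isolated.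
apply: (@joint_moment_isolated _ _ _ _ _ a) => // b k ba.
have := isolated b; rewrite ba/= negb_exists => /forallP/(_ k).
by rewrite negb_and -!eqn0Ngt => /orP[] /eqP; [left|right].
Qed.

Lemma sum_joint_moment_le (R : realDomainType) (N m : nat) (nu : nat -> nat -> R) (K : R) :
  (forall k, nu k 0%N = 1) -> (forall k j, odd j -> nu k j = 0) ->
  1 <= K -> (forall k j, (j <= 4 * m)%N -> `|nu k j| <= K ^+ j) ->
  \sum_(f : {ffun 'I_4 -> word N m} | f \in ffun_on (@closed_word N m))
     joint_moment N nu (fun a => mult (f a)) <=
  #|{set 'I_4}|%:R * K ^+ (4 * m) * ((m.*2 * 2) ^ (4 * m))%:R * N%:R ^+ (m.*2 + 2).
Proof.
move=> nu0 nu_odd K1 nuK.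
have B0 : 0 <= #|{set 'I_4}|%:R * K ^+ (4 * m) :> R.
  by rewrite mulr_ge0// exprn_ge0// (le_trans ler01).
rewrite (bigID (@balanced N m))/= [X in _ + X]big1 ?addr0; last first.
  by move=> f /andP[/ffun_onP fc]; apply: joint_moment_unbalanced.
apply: (@le_trans _ _ (\sum_(f : {ffun 'I_4 -> word N m} | balanced f) (#|{set 'I_4}|%:R * K ^+ (4 * m)))).
  rewrite [leRHS](bigID (mem (ffun_on (@closed_word N m))))/= -[leLHS]addr0.
  apply: lerD; last by apply: sumr_ge0.
  rewrite [leLHS](eq_bigl (fun f => balanced f && (f \in ffun_on (@closed_word N m)))); last first.
    by move=> f; rewrite andbC.
  apply: ler_sum => f _; apply: le_trans (ler_norm _) _.
  by apply: norm_joint_moment => // a; rewrite sum_mult.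
rewrite sumr_const -[leLHS]mulr_natr -[leRHS]mulrA ler_wpM2l// -natrX -natrM ler_nat.
exact: card_balanced.
Qed.

(** * Traces of powers as sums over closed words *)

Definition diag_var (R : realType) (T : Type) (b : nat -> T -> R) (k : nat) (w : T) : R :=
  if k == 0%N then 0 else b k w.

Lemma expr_mx_path (R : pzRingType) (N : nat) (A : 'M[R]_N) (m : nat) (i j : 'I_N) :
  (A ^+ m) i j = \sum_(t : m.-tuple 'I_N | nth i (i :: t) m == j)
     \prod_(s < m) A (nth i (i :: t) s) (nth i (i :: t) s.+1).
Proof.
elim: m i => [|m IH] i.
  rewrite expr0 mxE; have [_|_] := eqVneq i j.
    rewrite (big_pred1 [tuple])/= ?big_ord0// => t.
    by rewrite /= [t]tuple0; apply/esym/eqP; apply: val_inj.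
  by rewrite big_pred0.
rewrite exprS mxE.
rewrite (reindex (fun q : 'I_N * m.-tuple 'I_N => [tuple of q.1 :: q.2])); last first.
  exists (fun t => (thead t, [tuple of behead t])) => [[k t] _|t _]/=.
    by rewrite theadE; congr (_, _); apply: val_inj.
  by rewrite [RHS]tuple_eta.
(* Dropping the first step changes the default of [nth] from [i] to [k], harmless for indices inside
   the list. *)
have nthE k (t : m.-tuple 'I_N) s : (s <= m)%N -> nth i [:: i, k & t] s.+1 = nth k (k :: t) s.
  by move=> sm /=; apply: set_nth_default; rewrite /= size_tuple.
rewrite -(pair_big_dep xpredT
  (fun k (t : m.-tuple 'I_N) => nth i [:: i, k & t] m.+1 == j)
  (fun k (t : m.-tuple 'I_N) =>
     \prod_(s < m.+1) A (nth i [:: i, k & t] s) (nth i [:: i, k & t] s.+1)))/=.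
apply: eq_bigr => k _; rewrite IH big_distrr/=.
apply: eq_big => t; first by rewrite -nthE.
move=> _; rewrite big_ord_recl/=; congr (_ * _); apply: eq_bigr => s _.
by congr (A _ _); apply: set_nth_default; rewrite /= size_tuple //; have := ltn_ord s; lia.
Qed.

(** Steps with the same gap carry the same variable; grouping them produces the exponents [mult]. *)
Lemma trace_toeplitz (R : realType) (T : Type) (b : nat -> T -> R) (w : T) (N m : nat) :
  \tr (toeplitz N (fun k => b k w) ^+ m) =
  \sum_(x : word N m | closed_word x) \prod_(k < N) diag_var b k w ^+ mult x k.
Proof.
rewrite /mxtrace; under eq_bigr do rewrite expr_mx_path.
rewrite (pair_big_dep xpredT (fun i (t : m.-tuple 'I_N) => nth i (i :: t) m == i)
  (fun i (t : m.-tuple 'I_N) => \prod_(s < m)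
     toeplitz N (fun k => b k w) (nth i (i :: t) s) (nth i (i :: t) s.+1)))/=.
apply: eq_bigr => x _; rewrite (partition_big (gap x) xpredT)//=.
apply: eq_bigr => k _; rewrite /mult -prodr_const.
apply: eq_big => [s|s /eqP <-]; first by rewrite inE.
by rewrite mxE /diag_var.
Qed.

Import HBNNSimple.
Local Open Scope classical_set_scope.

(** * Moments of independent variables *)

Section weighted.
Context d (T : measurableType d) (R : realType) (mu : {measure set T -> \bar R}).
Variables (X : T -> R) (g : T -> R).
Hypotheses (mX : measurable_fun setT X) (mg : measurable_fun setT g).
Hypothesis g0 : forall x, 0 <= g x.

Lemma integral_weighted_nnsfun (h : {nnsfun R >-> R}) :
  (\int[mu]_x (h (X x) * g x)%:E =
   \sum_(r \in range h) r%:E * \int[mu]_(x in X @^-1` (h @^-1` [set r])) (g x)%:E)%E.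
Proof.
have mXI r : measurable (X @^-1` (h @^-1` [set r])).
  by rewrite -[X in measurable X]setTI; exact: mX.
have mge : measurable_fun setT (EFin \o g) by exact/measurable_EFinP.
transitivity (\int[mu]_x (\sum_(r \in range h)
   (r%:E * ((g x)%:E * (\1_(X @^-1` (h @^-1` [set r])) x)%:E))))%E.
  apply: eq_integral => x _; rewrite {1}(fimfunE h) EFinM -fsumEFin//.
  rewrite ge0_mule_fsuml; last first.
    by move=> r; rewrite lee_fin; have := nnfun_muleindic_ge0 h r (X x).
  by apply: eq_fsbigr => r _; rewrite EFinM -muleA (muleC (\1_ _ _)%:E).
rewrite ge0_integral_fsum//; last 2 first.
- move=> r; apply: emeasurable_funM => //; apply: emeasurable_funM => //.
  by apply/measurable_EFinP; exact: measurable_indic.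
- move=> r x _; have [r0|r0] := leP 0 r.
    by rewrite !mule_ge0 ?lee_fin.
  rewrite preimage_nnfun0// preimage_set0 indic0/= !mule0//.
apply: eq_fsbigr => r; rewrite inE => -[y _ <-].
rewrite ge0_integralZl ?lee_fin//=.
- rewrite [in RHS]integral_mkcond; congr (_ * _)%E; apply: eq_integral => x _.
  by rewrite epatch_indic.
- by apply: emeasurable_funM => //; apply/measurable_EFinP; exact: measurable_indic.
- by move=> x _; rewrite mule_ge0 ?lee_fin.
Qed.

(** Monotone convergence along simple functions expresses the integral through the integrals of [g]
    over preimages under [X] alone. *)
Lemma integral_weighted_lim (f : R -> R) (mf : measurable_fun setT (EFin \o f)) :
  (forall x, 0 <= f x) ->
  let h := nnsfun_approx measurableT mf in
  (\int[mu]_x (f (X x) * g x)%:E =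
   lim ((\sum_(r \in range (h n))
      r%:E * \int[mu]_(x in X @^-1` (h n @^-1` [set r])) (g x)%:E) @[n --> \oo]))%E.
Proof.
move=> f0 h.
transitivity (lim ((\int[mu]_x (h n (X x) * g x)%:E)%E @[n --> \oo])); last first.
  by congr (lim (_ @ \oo)); apply/funext => n; exact: integral_weighted_nnsfun.
transitivity (\int[mu]_x (lim ((h n (X x) * g x)%:E @[n --> \oo])))%E.
  apply: eq_integral => x _; apply/esym/cvg_lim => //.
  under eq_fun do rewrite EFinM.
  rewrite EFinM; apply: cvgeZr => //.
  apply: (@cvg_nnsfun_approx _ _ _ _ measurableT _ mf) => // y _.
  by rewrite lee_fin.
rewrite monotone_convergence//.
- move=> n; apply/measurable_EFinP; apply: measurable_funM => //.
  by apply: measurableT_comp.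
- by move=> n x _; rewrite lee_fin mulr_ge0.
- move=> x _ a b ab; rewrite lee_fin ler_wpM2r//.
  by apply/lefP/nd_nnsfun_approx => // y _; rewrite lee_fin.
Qed.

End weighted.

Lemma eq_integral_weighted (R : realType) d1 (T1 : measurableType d1)
    (mu1 : {measure set T1 -> \bar R}) d2 (T2 : measurableType d2)
    (mu2 : {measure set T2 -> \bar R}) (X1 g1 : T1 -> R) (X2 g2 : T2 -> R) (f : R -> R) :
  measurable_fun setT X1 -> measurable_fun setT g1 -> (forall x, 0 <= g1 x) ->
  measurable_fun setT X2 -> measurable_fun setT g2 -> (forall x, 0 <= g2 x) ->
  measurable_fun setT f -> (forall x, 0 <= f x) ->
  (forall A, measurable A -> \int[mu1]_(x in X1 @^-1` A) (g1 x)%:E =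
                             \int[mu2]_(x in X2 @^-1` A) (g2 x)%:E)%E ->
  (\int[mu1]_x (f (X1 x) * g1 x)%:E = \int[mu2]_x (f (X2 x) * g2 x)%:E)%E.
Proof.
move=> mX1 mg1 g10 mX2 mg2 g20 mf f0 eqA.
have mfE : measurable_fun setT (EFin \o f) by exact/measurable_EFinP.
rewrite (integral_weighted_lim mu1 mX1 mg1 g10 mfE)// (integral_weighted_lim mu2 mX2 mg2 g20 mfE)//=.
congr (lim (_ @ \oo)); apply/funext => n; apply: eq_fsbigr => r _.
by rewrite eqA.
Qed.

Lemma indic_bigsetI T (R : pzRingType) (B : nat -> set T) (s : seq nat) (x : T) :
  \1_(\big[setI/setT]_(i <- s) B i) x = \prod_(i <- s) (\1_(B i) x : R).
Proof.
elim: s => [|i s IH]; first by rewrite !big_nil indicT.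
by rewrite !big_cons indicI/= IH.
Qed.

Section independence.
Context (R : realType) (p : R -> R).
Hypothesis pd : is_density p.
Local Notation leb := (@lebesgue_measure R).

(** Since [fine] sends infinite values to 0, [pmean] is identified with the integral under
    [pintegrable]. *)
Definition pmean (f : R -> R) : R := fine (\int[leb]_x (f x * p x)%:E)%E.
Definition pintegrable (f : R -> R) := leb.-integrable setT (fun x => (f x * p x)%:E).

Let p0 : forall x, 0 <= p x. Proof. by case: pd. Qed.
Let mp : measurable_fun setT p. Proof. by case: pd => _ []. Qed.

Lemma pmeanE f : pintegrable f -> (\int[leb]_x (f x * p x)%:E)%E = (pmean f)%:E.
Proof. by move=> fi; rewrite fineK//; exact: integrable_fin_num. Qed.

Lemma pintegrable_indic (A : set R) : measurable A -> pintegrable \1_A.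
Proof.
move=> mA; have pint : leb.-integrable setT (EFin \o p).
  apply/integrableP; split; first exact/measurable_EFinP.
  case: pd => _ [_]; under [X in (X < _)%E]eq_integral do rewrite /= ger0_norm//.
  by move=> ->; rewrite ltry.
apply: (le_integrable measurableT _ _ pint).
- apply/measurable_EFinP; apply: measurable_funM => //; exact: measurable_indic.
- move=> x _ /=; rewrite lee_fin ger0_norm ?mulr_ge0// ger0_norm//.
  by rewrite indicE; case: (_ \in _); rewrite ?mul1r ?mul0r.
Qed.

Lemma pmean_indic (A : set R) : measurable A ->
  (\int[leb]_(x in A) (p x)%:E)%E = (pmean \1_A)%:E.
Proof.
move=> mA; rewrite -pmeanE; last exact: pintegrable_indic.
rewrite [LHS]integral_mkcond; apply: eq_integral => x _.
by rewrite epatch_indic/= -EFinM mulrC.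
Qed.

Context d (T : measurableType d) (P : probability T R) (b : nat -> {RV P >-> R}).
Hypothesis bP : iid_density P (fun i => (b i : T -> R)) p.
Variable (s : seq nat).
Hypotheses (us : uniq s) (s0 : all (fun i => 0 < i)%N s).

Let prod_indic (F : nat -> R -> R) :
  (forall i, i \in s -> exists A, measurable A /\ F i = \1_A) ->
  (\int[P]_w (\prod_(i <- s) F i (b i w))%:E = (\prod_(i <- s) pmean (F i))%:E)%E.
Proof.
move=> Find; have /choice[A AF] i : exists A, measurable A /\ (i \in s -> F i = \1_A).
  have [/Find[A [mA FA]]|si] := boolP (i \in s); first by exists A.
  by exists set0; split.
have mA i := (AF i).1; have FA i := (AF i).2; case: bP => bd bi.
transitivity (P (\big[setI/setT]_(i <- s) (b i @^-1` A i))).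
  rewrite -[X in P X]setIT -integral_indic//; last first.
    apply: big_ind => //; first exact: measurableI.
    by move=> i _; rewrite -[X in measurable X]setTI; exact: measurable_funPT.
  apply: eq_integral => w _; rewrite indic_bigsetI; congr (_%:E).
  by rewrite !big_seq; apply: eq_bigr => i si; rewrite FA.
rewrite bi// -prodEFin; rewrite !big_seq; apply: eq_bigr => i si.
by rewrite bd ?(allP s0)// FA// pmean_indic.
Qed.

(* Indicators are replaced by arbitrary functions one index [j] at a time: with the other
   factors fixed, both sides are integrals of [F j] against measures that agree on all
   measurable sets by the induction hypothesis. *)
Let prod_ge0 (l : seq nat) (F : nat -> R -> R) :
  (forall i, measurable_fun setT (F i)) -> (forall i x, 0 <= F i x) ->
  (forall i, pintegrable (F i)) ->
  (forall i, i \in s -> i \notin l -> exists A, measurable A /\ F i = \1_A) ->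
  (\int[P]_w (\prod_(i <- s) F i (b i w))%:E = (\prod_(i <- s) pmean (F i))%:E)%E.
Proof.
elim: l F => [|j l IH] F mF F0 iF indF.
  by apply: prod_indic => i si; exact: indF.
pose upd A i := if i == j then \1_A else F i.
have updE A : measurable A ->
    (\int[P]_w (\prod_(i <- s) upd A i (b i w))%:E = (\prod_(i <- s) pmean (upd A i))%:E)%E.
  move=> mA; apply: IH => [i|i x|i|i si il]; rewrite /upd; case: eqVneq => // ij.
  - exact: pintegrable_indic.
  - by exists A.
  - by apply: indF => //; rewrite in_cons negb_or ij.
have updN A i : i != j -> upd A i = F i by rewrite /upd => /negPf ->.
(* If [j] is not in [s], then [F j] does not occur, and the indicator of the whole line may stand in
   for it. *)
have [js|js] := boolP (j \in s); last first.
  transitivity (\int[P]_w (\prod_(i <- s) upd setT i (b i w))%:E)%E.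
    apply: eq_integral => w _; congr (_%:E); rewrite !big_seq; apply: eq_bigr => i si.
    by rewrite updN//; apply: contraNneq js => <-.
  rewrite updE//; congr (_%:E); rewrite !big_seq; apply: eq_bigr => i si.
  by rewrite updN//; apply: contraNneq js => <-.
pose g w := \prod_(i <- s | i != j) F i (b i w).
pose C := \prod_(i <- s | i != j) pmean (F i).
have mb i : measurable_fun setT (b i) by exact: measurable_funPT.
have mg : measurable_fun setT g.
  rewrite /g; under eq_fun do rewrite -big_filter.
  by apply: measurable_prod => i _; exact: measurableT_comp.
have C0 : 0 <= C.
  apply: prodr_ge0 => i _; apply: fine_ge0; apply: integral_ge0 => x _.
  by rewrite lee_fin mulr_ge0.
under eq_integral do rewrite (bigD1_seq j)//=.
rewrite (bigD1_seq j)//= -/C.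
transitivity (\int[leb]_x (F j x * (p x * C))%:E)%E.
  apply: (@eq_integral_weighted R _ T P _ _ leb (b j) g id (fun x => p x * C) (F j)) => //.
  - by move=> w; apply: prodr_ge0.
  - exact: measurable_funM.
  - by move=> x; rewrite mulr_ge0.
  move=> A mA.
  transitivity (\int[P]_w (\prod_(i <- s) upd A i (b i w))%:E)%E.
    rewrite [LHS]integral_mkcond; apply: eq_integral => w _.
    rewrite epatch_indic/= (bigD1_seq j)//= {1}/upd eqxx mulrC EFinM.
    by congr (_%:E * _)%E; apply: eq_bigr => i /updN ->.
  rewrite updE// (bigD1_seq j)//= {1}/upd eqxx.
  under eq_bigr => i /updN -> do [].
  rewrite -/C mulrC EFinM -pmean_indic// -ge0_integralZl//=.
  - by apply: eq_integral => x _; rewrite mulrC EFinM.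
  - by apply/measurable_EFinP; exact: measurable_funTS.
  - by move=> x _; rewrite lee_fin.
under eq_integral do rewrite mulrA mulrC EFinM.
rewrite integralZl//; last exact: iF.
by rewrite pmeanE; [rewrite -EFinM mulrC | exact: iF].
Qed.

Let prod_signed (l : seq nat) (F : nat -> R -> R) :
  (forall i, measurable_fun setT (F i)) -> (forall i, pintegrable (F i)) ->
  (forall i, i \notin l -> forall x, 0 <= F i x) ->
  P.-integrable setT (fun w => (\prod_(i <- s) F i (b i w))%:E) /\
  (\int[P]_w (\prod_(i <- s) F i (b i w))%:E = (\prod_(i <- s) pmean (F i))%:E)%E.
Proof.
have mb i : measurable_fun setT (b i) by exact: measurable_funPT.
elim: l F => [|j l IH] F mF iF F0.
  have EF : (\int[P]_w (\prod_(i <- s) F i (b i w))%:E = (\prod_(i <- s) pmean (F i))%:E)%E.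
    apply: (@prod_ge0 s) => // [i x|i -> //]; exact: F0.
  split=> //; apply/integrableP; split.
    by apply/measurable_EFinP; apply: measurable_prod => i _; exact: measurableT_comp.
  rewrite (eq_integral (fun w => (\prod_(i <- s) F i (b i w))%:E)); last first.
    by move=> w _; rewrite gee0_abs// lee_fin; apply: prodr_ge0 => i _; exact: F0.
  by rewrite EF ltry.
pose upd f i := if i == j then f else F i.
have updP (f : R -> R) : measurable_fun setT f -> pintegrable f -> (forall x, 0 <= f x) ->
    P.-integrable setT (fun w => (\prod_(i <- s) upd f i (b i w))%:E) /\
    (\int[P]_w (\prod_(i <- s) upd f i (b i w))%:E = (\prod_(i <- s) pmean (upd f i))%:E)%E.
  move=> mf intf f0; apply: IH => [i|i|i il]; rewrite /upd; case: eqVneq => // ij.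
  by apply: F0; rewrite in_cons negb_or ij.
have updN f i : i != j -> upd f i = F i by rewrite /upd => /negPf ->.
have [js|js] := boolP (j \in s); last first.
  have Fu i : i \in s -> F i = upd \1_setT i.
    by move=> si; rewrite updN//; apply: contraNneq js => <-.
  have -> : (fun w => (\prod_(i <- s) F i (b i w))%:E) =
            (fun w => (\prod_(i <- s) upd \1_setT i (b i w))%:E).
    by apply/funext => w; congr (_%:E); apply: eq_big_seq => i /Fu ->.
  rewrite (eq_big_seq (fun i => pmean (upd \1_setT i))); last by move=> i /Fu ->.
  by apply: updP => //; exact: pintegrable_indic.
pose fp x : R := Num.max (F j x) 0; pose fn x : R := Num.max (- F j x) 0.
have mfp : measurable_fun setT fp by exact: measurable_maxr.
have mfn : measurable_fun setT fn by apply: measurable_maxr => //; exact: measurableT_comp.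
have leint (f : R -> R) : measurable_fun setT f -> (forall x, `|f x| <= `|F j x|) -> pintegrable f.
  move=> mf fF; apply: (le_integrable measurableT _ _ (iF j)).
    by apply/measurable_EFinP; exact: measurable_funM.
  by move=> x _; rewrite lee_fin !normrM ler_wpM2r.
have ifp : pintegrable fp.
  by apply: leint => // x; rewrite /fp maxEle; case: ifP => _; rewrite ?normr0.
have ifn : pintegrable fn.
  by apply: leint => // x; rewrite /fn maxEle; case: ifP => _; rewrite ?normr0 ?normrN.
have fp0 x : 0 <= fp x by rewrite le_max lexx orbT.
have fn0 x : 0 <= fn x by rewrite le_max lexx orbT.
have [ip Ep] := updP fp mfp ifp fp0.
have [iN En] := updP fn mfn ifn fn0.
have Fpn x : F j x = fp x - fn x.
  by rewrite /fp /fn !maxEle oppr_le0; case: ltgtP => h; rewrite ?subr0 ?sub0r ?opprK.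
have Fw w : (\prod_(i <- s) F i (b i w))%:E =
    ((\prod_(i <- s) upd fp i (b i w))%:E - (\prod_(i <- s) upd fn i (b i w))%:E)%E.
  rewrite -EFinB; congr (_%:E); rewrite !(bigD1_seq j)//= Fpn mulrBl {1 3}/upd eqxx.
  by congr (_ * _ - _ * _); apply: eq_bigr => i /updN ->.
under eq_fun do rewrite Fw.
split; first exact: integrableB.
rewrite integralB// Ep En -EFinB; congr (_%:E).
rewrite !(bigD1_seq j)//= {1 3}/upd eqxx.
have -> : pmean (F j) = pmean fp - pmean fn.
  rewrite /pmean -fineB ?integrable_fin_num// -integralB//; congr fine.
  by apply: eq_integral => x _; rewrite /= -EFinB -mulrBl Fpn.
by rewrite mulrBl; congr (_ * _ - _ * _); apply: eq_bigr => i /updN ->.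
Qed.

Lemma expectation_prod_independent (F : nat -> R -> R) :
  (forall i, measurable_fun setT (F i)) -> (forall i, pintegrable (F i)) ->
  P.-integrable setT (fun w => (\prod_(i <- s) F i (b i w))%:E) /\
  (\int[P]_w (\prod_(i <- s) F i (b i w))%:E = (\prod_(i <- s) pmean (F i))%:E)%E.
Proof.
(* Outside [s] the functions become the constant 1, so that [prod_signed] applies with [l := s]. *)
move=> mF iF; pose F' i := if i \in s then F i else \1_setT.
have F'E i : i \in s -> F i = F' i by rewrite /F' => ->.
have -> : (fun w => (\prod_(i <- s) F i (b i w))%:E) = (fun w => (\prod_(i <- s) F' i (b i w))%:E).
  by apply/funext => w; congr (_%:E); apply: eq_big_seq => i /F'E ->.
rewrite (eq_big_seq (fun i => pmean (F' i))); last by move=> i /F'E ->.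
apply: (@prod_signed s) => i; rewrite /F'; case: ifP => // _.
by exact: pintegrable_indic.
Qed.

End independence.

(* The zero diagonal is the constant variable [0], whose moments are [0 ^+ j]. *)
Definition diag_moment (R : realType) (p : R -> R) (k j : nat) : R :=
  if k == 0%N then (j == 0%N)%:R else pmean p (fun x => x ^+ j).

(** * Moments of the density and expectations of monomials *)

Section moments.
Context (R : realType) (p : R -> R).
Hypotheses (pd : is_density p) (pm : mean0_var1_all_moments p).
Hypothesis (peven : forall x, p (- x) = p x).
Local Notation leb := (@lebesgue_measure R).

Lemma pmean_exp0 : pmean p (fun x => x ^+ 0) = 1.
Proof.
rewrite /pmean; under eq_integral do rewrite expr0 mul1r.
by case: pd => _ [_ ->].
Qed.

Lemma pmean_odd j : odd j -> pmean p (fun x => x ^+ j) = 0.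
Proof.
move=> oj; set f := fun x : R => (x ^+ j * p x)%:E.
have intf : leb.-integrable setT f by exact: (pm.1 j).
have fN x : f (- x) = (- f x)%E by rewrite /f exprNn -signr_odd oj expr1 mulN1r mulNr peven.
(* Reflection preserves Lebesgue measure and negates [f]. *)
have E : (\int[leb]_x f x = - \int[leb]_x f x)%E.
  rewrite -integralN; last exact: integrable_add_def.
  transitivity (\int[leb]_(x in (-%R : _ -> measurableTypeR R) @^-1` setT) (f \o -%R) x)%E.
    rewrite -integral_pushforward//=.
    - by apply: eq_measure_integral => //= A mA _; exact/esym/lebesgue_measureN.
    - exact: measurable_int intf.
    - rewrite preimage_setT (_ : f \o _ = \- f)%E; first exact: integrableN.
      by apply/funext => x /=; rewrite fN.
  by rewrite preimage_setT; apply: eq_integral => x _ /=; rewrite fN.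
apply/eqP; rewrite -[_ == 0](@mulrn_eq0 _ _ 2) /= mulr2n addr_eq0; apply/eqP.
by rewrite -fineN /pmean -/f {1}E.
Qed.

Lemma diag_moment0 k : diag_moment p k 0 = 1.
Proof. by rewrite /diag_moment; case: ifP => // _; exact: pmean_exp0. Qed.

Lemma diag_moment_odd k j : odd j -> diag_moment p k j = 0.
Proof. by rewrite /diag_moment; case: ifP => [_|_ /pmean_odd//]; case: j. Qed.

Context d (T : measurableType d) (P : probability T R) (b : nat -> {RV P >-> R}).
Hypothesis bP : iid_density P (fun i => (b i : T -> R)) p.

Lemma integral_monomial (N : nat) (c : nat -> nat) :
  P.-integrable setT (fun w => (\prod_(k < N) diag_var (fun i => b i : T -> R) k w ^+ c k)%:E) /\
  (\int[P]_w (\prod_(k < N) diag_var (fun i => b i : T -> R) k w ^+ c k)%:E =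
   (\prod_(k < N) diag_moment p k (c k))%:E)%E.
Proof.
case: N => [|N].
  set g := fun w : T => _; have -> : g = cst 1%E by apply/funext => w; rewrite /g big_ord0.
  rewrite big_ord0; split; first exact: finite_measure_integrable_cst.
  by rewrite (integral_cst P measurableT) mul1e; exact: probability_setT.
(* Index 0 is split off: independence concerns positive indices, and the zero diagonal contributes
   the constant [0 ^+ c 0]. *)
pose z : R := (c 0%N == 0%N)%:R.
have [iP EP] := @expectation_prod_independent _ _ pd _ _ _ _ bP (iota 1 N) (iota_uniq _ _)
  (ltac:(by apply/allP => i; rewrite mem_iota => /andP[])) (fun i x => x ^+ c i)
  (fun i => measurable_funX _ (@measurable_id _ _ _)) (fun i => pm.1 _).
have E w : (\prod_(k < N.+1) diag_var (fun i => b i : T -> R) k w ^+ c k)%:E =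
    (z%:E * (\prod_(i <- iota 1 N) b i w ^+ c i)%:E)%E.
  rewrite -EFinM big_ord_recl expr0n; congr (_ * _)%:E.
  rewrite (iotaDl 1 0) big_map -/(index_iota 0 N) -val_enum_ord.
  by rewrite big_map big_enum; apply: eq_bigr.
split.
  under eq_fun do rewrite E; exact: integrableZl.
under eq_integral do rewrite E; rewrite integralZl// EP -EFinM; congr (_%:E).
rewrite big_ord_recl /diag_moment/=; congr (_ * _).
rewrite (iotaDl 1 0) big_map -val_enum_ord.
by rewrite big_map big_enum; apply: eq_bigr.
Qed.

Lemma expectation_lincomb (N : nat) (I : finType) (Q : pred I) (a : I -> R) (c : I -> nat -> nat) :
  ('E_P[fun w => (\sum_(i | Q i) a i *
             \prod_(k < N) diag_var (fun i => b i : T -> R) k w ^+ c i k)%R] =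
   (\sum_(i | Q i) a i * \prod_(k < N) diag_moment p k (c i k))%R%:E)%E.
Proof.
rewrite unlock; under eq_integral do rewrite -sumEFin.
have iM i := integral_monomial N (c i).
rewrite integral_sum//; last first.
  move=> i; under eq_fun do rewrite EFinM; apply: integrableZl => //.
  exact: (iM i).1.
rewrite -sumEFin; apply: eq_bigr => i _.
under eq_integral do rewrite EFinM.
by rewrite integralZl//; [rewrite (iM i).2 EFinM|exact: (iM i).1].
Qed.

End moments.

(** * The fourth central moment bound *)

Theorem theorem6 (R : realType) (p : R -> R) :
  is_density p -> mean0_var1_all_moments p -> (forall x, p (- x) = p x) ->
  forall m : nat, exists C : R,
    forall (d : measure_display) (T : measurableType d) (P : probability T R)
           (b : nat -> {RV P >-> R}),
      iid_density P (fun i => (b i : T -> R)) p ->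
      forall N : nat, (1 <= N)%N ->
        ('E_P[fun w => (`| Mstat N m (fun k => b k w)
                          - fine 'E_P[fun w' => Mstat N m (fun k => b k w')] | ^+ 4)%R]
         <= (C / N%:R ^+ 2)%:E)%E.
Proof.
move=> pd pm peven m.
(* [K] dominates every moment up to order [4 * m], and [1 <= K] gives [K <= K ^+ j] for positive
   [j]. *)
pose K : R := 1 + \sum_(j < (4 * m).+1) `|pmean p (fun x => x ^+ j)|.
have K1 : 1 <= K by rewrite lerDl sumr_ge0.
have nu0 := diag_moment0 pd.
have nu_odd := diag_moment_odd pm peven.
have nuK k j : (j <= 4 * m)%N -> `|diag_moment p k j| <= K ^+ j.
  case: j => [|j] jm; first by rewrite nu0 normr1 expr0.
  apply: (@le_trans _ _ K); last by rewrite ler_eXnr.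
  rewrite /diag_moment; case: ifP => _; first by rewrite normr0 (le_trans ler01).
  rewrite /K (bigD1 (Ordinal (jm : (j.+1 < (4 * m).+1)%N)))//=.
  by rewrite addrCA lerDl addr_ge0// sumr_ge0.
(* The factors are the number of sets [J], the bound on each term and the number of patterns; none
   depends on [N] or [P]. *)
pose C := #|{set 'I_4}|%:R * K ^+ (4 * m) * ((m.*2 * 2) ^ (4 * m))%:R.
exists C => d T P b bP N N1.
pose c : R := N%:R `^ (- (m%:R / 2 + 1)).
pose X := diag_var (fun i => b i : T -> R).
pose E (w : word N m) := mono_moment N (diag_moment p) (mult w).
have MstatE w : Mstat N m (fun k => b k w) =
    \sum_(x : word N m | closed_word x) c * \prod_(k < N) X k w ^+ mult x k.
  by rewrite /Mstat (trace_toeplitz (fun i => b i : T -> R)) big_distrr.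
have -> : fine ('E_P[fun w' => Mstat N m (fun k => b k w')])%E =
    c * \sum_(x : word N m | closed_word x) E x.
  rewrite (funext MstatE).
  by rewrite (expectation_lincomb pd pm bP)/= -big_distrr.
pose q_coef (q : {ffun 'I_4 -> word N m} * {set 'I_4}) :=
  c ^+ 4 * \prod_(a | a \notin q.2) - E (q.1 a).
pose q_mult (q : {ffun 'I_4 -> word N m} * {set 'I_4}) k :=
  (\sum_(a in q.2) mult (q.1 a) k)%N.
have M4E w : `|Mstat N m (fun k => b k w) - c * \sum_(x : word N m | closed_word x) E x| ^+ 4 =
    \sum_(q | q.1 \in ffun_on (@closed_word N m)) q_coef q * \prod_(k < N) X k w ^+ q_mult q k.
  rewrite -normrX ger0_norm ?exprn_even_ge0//.
  rewrite MstatE -big_distrr -mulrBr exprMn (expr_sum_sub _ 4 N (fun k => X k w) (@mult N m)).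
  by rewrite big_distrr; apply: eq_bigr => q _; rewrite /= mulrA.
rewrite (funext M4E).
rewrite (expectation_lincomb pd pm bP) lee_fin.
(* Summing over the sets [q.2] first reassembles the joint central moments. *)
have -> : \sum_(q | q.1 \in ffun_on (@closed_word N m))
      q_coef q * \prod_(k < N) diag_moment p k (q_mult q k) =
    c ^+ 4 * \sum_(f : {ffun 'I_4 -> word N m} | f \in ffun_on (@closed_word N m))
     joint_moment N (diag_moment p) (fun a => mult (f a)).
  rewrite /joint_moment pair_big_dep big_distrr/=.
  by apply: eq_big => [q|q _]; rewrite ?andbT// mulrA.
have NR : 0 < N%:R :> R by rewrite ltr0n.
(* The exponents add up: [-4 (m/2 + 1) + (2m + 2) = -2]. *)
have cN : c ^+ 4 * N%:R ^+ (m.*2 + 2) = (N%:R ^+ 2)^-1 :> R.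
  have -> : c ^+ 4 = N%:R `^ (- (m%:R / 2 + 1) * 4%:R) by rewrite powRrM powR_mulrn// powR_ge0.
  have -> : (N%:R ^+ 2)^-1 = N%:R `^ (- 2%:R) :> R by rewrite powRN powR_mulrn// ltW.
  rewrite -(@powR_mulrn _ N%:R) ?ltW// -powRD; last by rewrite (gt_eqF NR) implybT.
  by congr (_ `^ _); rewrite natrD -muln2 natrM; field.
rewrite -cN mulrCA ler_wpM2l ?exprn_ge0 ?powR_ge0//.
exact: sum_joint_moment_le.
Qed.
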